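(* Consider the problem of minimizing $$\mathcal{J}^2(\boldsymbol{\psi}^2,\boldsymbol{g}^2)=\mathbb{E}\Big[\sum_{t=0}^T c_t\big(X_t,\Gamma_t^{[2,1]}(\Pi_t^1),U_t^2\big)\Big]$$ over all prescription strategies $\boldsymbol{\psi}^2$ and control strategies $\boldsymbol{g}^2$ of agent 2, where $\Gamma_t^{[2,1]}=\psi_t^{[2,1]}(M_t^2)$, $U_t^1=\Gamma_t^{[2,1]}(\Pi_t^1)$ and $U_t^2=g_t^2(M_t^2)$ for $t=0,\dots,T$. Without loss of optimality, one can restrict attention to prescription strategies $\boldsymbol{\psi}^{*2}$ and control strategies $\boldsymbol{g}^{*2}$ with the structural form $$\Gamma_t^{[2,1]}=\psi_t^{*[2,1]}(\Pi_t^2),\qquad U_t^2=g_t^{*2}(\Pi_t^2),\qquad t=0,\dots,T;$$ that is, for every pair $(\boldsymbol{\psi}^2,\boldsymbol{g}^2)$ there is a pair $(\boldsymbol{\psi}^{*2},\boldsymbol{g}^{*2})$ of this structural form with $\mathcal{J}^2(\boldsymbol{\psi}^{*2},\boldsymbol{g}^{*2})\le\mathcal{J}^2(\boldsymbol{\psi}^2,\boldsymbol{g}^2)$.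
   Context: Team model. Fix $T\in\mathbb{N}$; time runs over $t=0,\dots,T$. The state $X_t$ takes values in a finite set $\mathcal{X}_t$. Agents $k\in\{1,2\}$ choose actions $U_t^k$ in finite sets $\mathcal{U}_t^k$ and receive observations $Y_t^k$ in finite sets $\mathcal{Y}_t^k$. The dynamics are $X_{t+1}=f_t(X_t,U_t^1,U_t^2,W_t)$ for $t=0,\dots,T-1$, and $Y_t^k=h_t^k(X_t,V_t^k)$ for $t=0,\dots,T$, where the disturbances $W_t$ and noises $V_t^k$ take values in finite sets. The primitive random variables $X_0$, $W_t$, $V_t^1$, $V_t^2$ ($t=0,\dots,T$) are mutually independent with known distributions. The cost functions are $c_t:\mathcal{X}_t\times\mathcal{U}_t^1\times\mathcal{U}_t^2\to\mathbb{R}_{\ge 0}$. Memories (nested information). $M_t^2=\{Y_{0:t}^2,U_{0:t-1}^2\}$ and $M_t^1=\{Y_{0:t}^1,U_{0:t-1}^1,Y_{0:t}^2,U_{0:t-1}^2\}$, with (finite) sets of possible values $\mathcal{M}_t^2$ and $\mathcal{M}_t^1$; here $A_{0:t}=(A_0,\dots,A_t)$. Put $L_t^{[1,2]}=M_t^1\setminus M_t^2=\{Y_{0:t}^1,U_{0:t-1}^1\}$, with finite set of possible values $\mathcal{L}_t^{[1,2]}$. Prescriptions. Let $\mathcal{P}_t^1=\Delta(\mathcal{X}_t)$ and $\Pi_t^1=\mathbb{P}(X_t\mid M_t^1)$, the conditional distribution of $X_t$ given $M_t^1$ under the strategies in use. A prescription of agent 2 for agent 1 is a function $\Gamma_t^{[2,1]}:\mathcal{P}_t^1\to\mathcal{U}_t^1$;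 $\mathcal{F}_t^{[2,1]}$ is the set of such functions. A prescription strategy is $\boldsymbol{\psi}^2=(\psi_0^{[2,1]},\dots,\psi_T^{[2,1]})$ with $\psi_t^{[2,1]}:\mathcal{M}_t^2\to\mathcal{F}_t^{[2,1]}$. A control strategy of agent 2 is $\boldsymbol{g}^2=(g_0^2,\dots,g_T^2)$ with $g_t^2:\mathcal{M}_t^2\to\mathcal{U}_t^2$. The expectation in $\mathcal{J}^2$ is under the process generated by $(\boldsymbol{\psi}^2,\boldsymbol{g}^2)$. Information state of agent 2. $\Pi_t^2=\mathbb{P}(X_t,L_t^{[1,2]}\mid M_t^2,\Gamma_{0:t-1}^{[2,1]})$ is the conditional joint distribution under the strategies in use, taking values in $\mathcal{P}_t^2=\Delta(\mathcal{X}_t\times\mathcal{L}_t^{[1,2]})$. Structured laws are functions $\psi_t^{*[2,1]}:\mathcal{P}_t^2\to\mathcal{F}_t^{[2,1]}$ and $g_t^{*2}:\mathcal{P}_t^2\to\mathcal{U}_t^2$; $\Pi_t^1,\Pi_t^2$ at time $t$ depend on the strategies only through laws at times $0,\dots,t-1$. *)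

(* Defs.v *)
From HB Require Import structures.
From mathcomp Require Import all_boot all_order all_algebra.
From mathcomp Require Import all_classical all_reals all_analysis.

Set Implicit Arguments.
Unset Strict Implicit.
Unset Printing Implicit Defensive.

Import Order.TTheory GRing.Theory Num.Theory.
Local Open Scope classical_set_scope.
Local Open Scope ring_scope.

(* The simplex Delta(A) over a finite set A. *)
Section Dist.
Variables (R : realType) (A : finType).

Definition is_dist (p : {ffun A -> R}) : bool :=
  [forall a, 0 <= p a] && (\sum_a p a == 1).

Record dist := Dist { pmf_of :> {ffun A -> R}; _ : is_dist pmf_of }.

HB.instance Definition _ := [isSub of dist for pmf_of].

Definition point_mass_ffun (a0 : A) : {ffun A -> R} :=
  [ffun a => (a == a0)%:R].

Lemma point_mass_subproof a0 : is_dist (point_mass_ffun a0).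
Proof.
apply/andP; split; first by apply/forallP => a; rewrite ffunE ler0n.
rewrite (bigD1 a0)//= ffunE eqxx big1 ?addr0// => a /negPf aa0.
by rewrite ffunE aa0.
Qed.

Definition point_mass (a0 : A) : dist := Dist (point_mass_subproof a0).

End Dist.

Section FiniteValued.
Variables (R : realType) (d : measure_display) (Omega : measurableType d).
Variable P : probability Omega R.

Definition fin_measurable (A : finType) (Z : Omega -> A) : Prop :=
  forall a, measurable (Z @^-1` [set a]).

(* For a finite family the product rule for all events [E] includes the rule
   for every subfamily: take [E i = setT] for the indices left out. *)
Definition mutually_independent (I : finType) (A : I -> finType)
    (Z : forall i, Omega -> A i) : Prop :=
  forall E : forall i, set (A i),
    fine (P [set w | forall i, E i (Z i w)]) =
    \prod_i fine (P (Z i @^-1` E i)).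

(* Conditional law P(Z = . | B).  If P B = 0 the candidate mass function
   vanishes (division by 0 yields 0), hence is not in Delta(A), and an
   arbitrary value is used instead; see [cond_lawE] for P B != 0. *)
Definition cond_law (A : finType) (Z : Omega -> A) (B : set Omega) : dist R A :=
  insubd (point_mass R (Z point))
    [ffun a => fine (P (Z @^-1` [set a] `&` B)) / fine (P B)].

Lemma cond_lawE (A : finType) (Z : Omega -> A) (B : set Omega) (a : A) :
  fin_measurable Z -> measurable B -> P B != 0%E ->
  cond_law Z B a = fine (P (Z @^-1` [set a] `&` B)) / fine (P B).
Proof.
move=> mZ mB PB0; rewrite /cond_law -[pmf_of _]/(val _) insubdK ?ffunE//.
have mI x : measurable (Z @^-1` [set x] `&` B) by exact: measurableI.
have PB0' : fine (P B) != 0.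
  by apply: contra PB0 => /eqP PB; rewrite -(fineK (fin_num_measure P _ mB)) PB.
rewrite unfold_in; apply/andP; split.
  by apply/forallP => x; rewrite ffunE divr_ge0// fine_ge0.
under eq_bigr do rewrite ffunE.
rewrite -mulr_suml; suff -> : \sum_a fine (P (Z @^-1` [set a] `&` B)) = fine (P B).
  by rewrite divff.
apply: EFin_inj; rewrite -sumEFin fineK ?fin_num_measure//.
under eq_bigr do rewrite fineK ?fin_num_measure//.
rewrite fsbig_seq ?index_enum_uniq// -measure_fin_bigcup//.
- congr (P _); apply/seteqP; split => [w [x _ []]//|w Bw].
  by exists (Z w) => //=; rewrite mem_index_enum.
- by move=> i j _ _ [w [[/= <- _] [/= <- _]]].
Qed.

End FiniteValued.

(* All time-indexed data are families over nat; only the indices t <= horizon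
   (for [dyn]: t < horizon) matter. *)
Record team_model (R : realType) := TeamModel {
  horizon : nat;
  Xs : nat -> finType;
  U1s : nat -> finType;
  U2s : nat -> finType;
  Y1s : nat -> finType;
  Y2s : nat -> finType;
  Ws : nat -> finType;
  V1s : nat -> finType;
  V2s : nat -> finType;
  dyn : forall t, Xs t -> U1s t -> U2s t -> Ws t -> Xs t.+1;
  obs1 : forall t, Xs t -> V1s t -> Y1s t;
  obs2 : forall t, Xs t -> V2s t -> Y2s t;
  cost : forall t, Xs t -> U1s t -> U2s t -> R;
  cost_ge0 : forall t x u1 u2, (t <= horizon)%N -> 0 <= @cost t x u1 u2
}.

(* Values of (Y_{0:t}, U_{0:t-1}), listed as (Y_0, U_0, Y_1, ..., U_{t-1}, Y_t). *)
Fixpoint history (Y U : nat -> finType) (t : nat) : finType :=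
  match t with
  | 0 => Y 0%N
  | s.+1 => (history Y U s * U s * Y s.+1)%type
  end.

Section Model.
Variables (R : realType) (M : team_model R).

Definition mem2 (t : nat) : finType := history (Y2s M) (U2s M) t.
Definition priv1 (t : nat) : finType := history (Y1s M) (U1s M) t.
Definition mem1 (t : nat) : finType := (mem2 t * priv1 t)%type.

Definition prescription (t : nat) : Type := dist R (Xs M t) -> U1s M t.
Definition presc_strategy : Type := forall t, mem2 t -> prescription t.
Definition control_strategy : Type := forall t, mem2 t -> U2s M t.

Definition info2 (t : nat) : Type := dist R (Xs M t * priv1 t)%type.
Definition presc_law : Type := forall t, info2 t -> prescription t.
Definition control_law : Type := forall t, info2 t -> U2s M t.

Variables (d : measure_display) (Omega : measurableType d).

Record primitives := Primitives {
  X0 : Omega -> Xs M 0;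
  W : forall t, Omega -> Ws M t;
  V1 : forall t, Omega -> V1s M t;
  V2 : forall t, Omega -> V2s M t
}.

Variables (P : probability Omega R) (N : primitives).

Definition prim_index : finType :=
  (unit + 'I_(horizon M).+1 + 'I_(horizon M).+1 + 'I_(horizon M).+1)%type.

Definition prim_space (i : prim_index) : finType :=
  match i with
  | inl (inl (inl _)) => Xs M 0
  | inl (inl (inr t)) => Ws M t
  | inl (inr t) => V1s M t
  | inr t => V2s M t
  end.

Definition prim (i : prim_index) : Omega -> prim_space i :=
  match i return Omega -> prim_space i with
  | inl (inl (inl _)) => X0 N
  | inl (inl (inr t)) => W N t
  | inl (inr t) => V1 N t
  | inr t => V2 N t
  end.

Definition independent_primitives : Prop :=
  (forall i, fin_measurable (prim i)) /\ mutually_independent P prim.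

Variables (psi : presc_strategy) (g : control_strategy).

(* The random vector (X_t, (M_t^2, L_t)); its second component is M_t^1.  The
   belief Pi_t^1 used by U_t^1 is computed from the law of the process up to
   time t, so the recursion is on random variables, not on sample paths. *)
Fixpoint process (t : nat) : Omega -> Xs M t * mem1 t :=
  match t return Omega -> Xs M t * mem1 t with
  | 0 => fun w =>
      let x := X0 N w in
      (x, (obs2 x (V2 N 0 w), obs1 x (V1 N 0 w)))
  | s.+1 => fun w =>
      let: (x, (m2, l)) := process s w in
      let pi1 := cond_law P (fun w' => (process s w').1)
                   [set w' | (process s w').2 = (m2, l)] in
      let u1 := psi m2 pi1 in
      let u2 := g m2 in
      let x' := dyn x u1 u2 (W N s w) in
      (x', ((m2, u2, obs2 x' (V2 N s.+1 w)), (l, u1, obs1 x' (V1 N s.+1 w))))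
  end.

Definition state (t : nat) (w : Omega) : Xs M t := (process t w).1.
Definition memory1 (t : nat) (w : Omega) : mem1 t := (process t w).2.
Definition memory2 (t : nat) (w : Omega) : mem2 t := (memory1 t w).1.
Definition private1 (t : nat) (w : Omega) : priv1 t := (memory1 t w).2.

Definition Pi1 (t : nat) (w : Omega) : dist R (Xs M t) :=
  cond_law P (state t) [set w' | memory1 t w' = memory1 t w].

Definition Gamma (t : nat) (w : Omega) : prescription t := psi (memory2 t w).
Arguments Gamma : clear implicits.
Definition U1 (t : nat) (w : Omega) : U1s M t := Gamma t w (Pi1 t w).
Definition U2 (t : nat) (w : Omega) : U2s M t := g (memory2 t w).

Definition Pi2 (t : nat) (w : Omega) : info2 t :=
  cond_law P (fun w' => (state t w', private1 t w'))
    [set w' | memory2 t w' = memory2 t w /\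
              forall s, (s < t)%N -> Gamma s w' = Gamma s w].

Definition total_cost (w : Omega) : R :=
  \sum_(t < (horizon M).+1) cost (state t w) (U1 t w) (U2 t w).

Definition J : \bar R := ('E_P[total_cost])%E.

(* Pi_t^1 and Pi_t^2 depend only on (psi, g) at times before t, so these
   equations determine, by recursion on t, the process up to the horizon from
   the laws (psis, gs): (psi, g) is the realization of (psis, gs) as functions
   of M_t^2. *)
Definition structural_form (psis : presc_law) (gs : control_law) : Prop :=
  forall t w, (t <= horizon M)%N ->
    Gamma t w = psis t (Pi2 t w) /\ U2 t w = gs t (Pi2 t w).

Lemma stateS t w :
  state t.+1 w = dyn (state t w) (U1 t w) (U2 t w) (W N t w).
Proof.
rewrite /state /U1 /U2 /Gamma /Pi1 /memory2 /memory1 /=.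
by case: (process t w) => x [m2 l].
Qed.

Lemma memory2S t w :
  memory2 t.+1 w =
  (memory2 t w, U2 t w, obs2 (state t.+1 w) (V2 N t.+1 w)).
Proof.
by rewrite /state /U2 /memory2 /memory1 /=; case: (process t w) => x [m2 l].
Qed.

Lemma private1S t w :
  private1 t.+1 w =
  (private1 t w, U1 t w, obs1 (state t.+1 w) (V1 N t.+1 w)).
Proof.
rewrite /state /U1 /private1 /Gamma /Pi1 /memory2 /memory1 /=.
by case: (process t w) => x [m2 l].
Qed.

End Model.

(* Main.v *)
Require Import Defs.
From mathcomp Require Import all_boot all_order all_algebra.
From mathcomp Require Import all_classical all_reals all_analysis.
From mathcomp Require Import measurable_realfun.

(** The idea is dynamic programming on unnormalized conditional laws.  For a
    value [m] of agent 2's memory put [joint m x l] = P(X_t = x, L_t = l,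
    M_t^2 = m).  Three facts carry the proof.

    The evolution of [joint] is a controlled deterministic system.  As W_t and
    the noises at time t+1 are independent of the process up to time t
    ([process_indep]), [joint (m, u2, y2)] is obtained from [joint m], the
    response of agent 1 and [u2] by a linear map [update] that does not depend
    on the strategies ([joint_step]).  The belief Pi_t^1 is read off from
    [joint m] by conditioning on l ([belief_joint]), so a prescription and
    [joint m] determine the response of agent 1; and the expected cost at time
    t is a sum over [m] of a linear function of [joint m] ([J_expected_cost]).
    Hence the backward recursion [value], a minimum over prescriptions and
    actions of agent 2, bounds from below the cost of every pair of strategies
    ([value_le_cost_to_go]), with equality if the choice at each memory attains
    the minimum ([value_eq_cost_to_go]).  At time 0 [joint] does not depend on
    the strategies, so the two bounds compare.

    The minimum is attained although there are infinitely many prescriptions: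
    only their values at the finitely many beliefs given by the possible l
    matter ([decision_value_min]).

    The minimizer can be chosen as a function of Pi_t^2 alone: [joint m] is
    P(M_t^2 = m) times Pi_t^2 ([joint_posterior2]), and the quantity to minimize
    is homogeneous of degree one ([decision_value_scale]), so a minimizer for
    Pi_t^2 is one for [joint m].  Null memories, at which Pi_t^2 is
    an arbitrary point mass, correspond to the factor 0.

    It remains that laws on Pi_t^2 are realized by strategies on memories; this
    is a recursion on time, since Pi_t^2 depends only on earlier decisions
    ([feedback_realization]). *)

Set Implicit Arguments.
Unset Strict Implicit.
Unset Printing Implicit Defensive.

Import Order.TTheory GRing.Theory Num.Theory.
Local Open Scope classical_set_scope.
Local Open Scope ring_scope.

(** * Minima of functions with finitely many values *)

Section FiniteMin.
Variables (R : realType) (S : Type) (A : finType) (h : S -> A) (F : S -> R).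
Hypothesis Fh : forall s s', h s = h s' -> F s = F s'.

Lemma finite_min_exists (s0 : S) : exists s1, forall s, F s1 <= F s.
Proof.
(* [rep] chooses a preimage of each attained value of [h]; minimizing [F]
   over the finite type [A] through [rep] then minimizes it over [S]. *)
have ex a : exists s, (exists s', h s' = a) -> h s = a.
  by have [[s' <-]|nex] := pselect (exists s', h s' = a); [exists s'|exists s0].
pose rep a := projT1 (cid (ex a)).
have repE s : F (rep (h s)) = F s.
  by apply: Fh; rewrite /rep; case: cid => s' /=; apply; exists s.
have [a _ amin] := @arg_minP _ R A (h s0) xpredT (F \o rep) isT.
by exists (rep a) => s; rewrite -(repE s); exact: amin.
Qed.

End FiniteMin.

Lemma inf_rangeE (R : realType) (S : Type) (F : S -> R) (s1 : S) :
  (forall s, F s1 <= F s) -> inf (range F) = F s1.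
Proof.
move=> s1min; apply/le_anti/andP; split.
  by apply: ge_inf; [exists (F s1) => _ [s _ <-]; exact: s1min|exists s1].
by apply: lb_le_inf; [exists (F s1); exists s1|move=> _ [s _ <-]].
Qed.

(** * Finite-valued random variables and independence *)

Section FiniteProbability.
Variables (R : realType) (d : measure_display) (Omega : measurableType d).
Variable P : probability Omega R.

Lemma fin_measurable_preimage (A : finType) (Z : Omega -> A) (B : set A) :
  fin_measurable Z -> measurable (Z @^-1` B).
Proof.
move=> mZ; rewrite (_ : Z @^-1` B = \bigcup_(a in B) Z @^-1` [set a]).
  by apply: fin_bigcup_measurable => [|a _]; [exact: finite_finset|exact: mZ].
by apply/seteqP; split => [w Bw|w [a Ba /= ->]//]; exists (Z w).
Qed.

Lemma measurable_fun_fin_valued (A : finType) (Z : Omega -> A) (C : A -> R) :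
  fin_measurable Z -> measurable_fun setT (C \o Z).
Proof.
by move=> mZ _ B _; rewrite setTI; exact: fin_measurable_preimage (C @^-1` B) mZ.
Qed.

Lemma prob_bigcup_fin (A : finType) (F : A -> set Omega) :
  (forall a, measurable (F a)) ->
  (forall a b w, F a w -> F b w -> a = b) ->
  fine (P (\bigcup_a F a)) = \sum_a fine (P (F a)).
Proof.
move=> mF dF; apply: EFin_inj.
have mU : measurable (\bigcup_a F a).
  by apply: fin_bigcup_measurable => // a _; exact: finite_finset.
rewrite -sumEFin fineK ?fin_num_measure//.
under eq_bigr do rewrite fineK ?fin_num_measure//.
rewrite fsbig_seq ?index_enum_uniq// -measure_fin_bigcup//.
- congr (P _); apply/seteqP; split => [w [a _ Faw]|w [a _ Faw]]; exists a => //=.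
  by rewrite mem_index_enum.
- by move=> a b _ _ [w [Fa Fb]]; exact: dF Fa Fb.
Qed.

Section IndependentEvents.
Variables (I : finType) (A : I -> finType) (Z : forall i, Omega -> A i).
Hypothesis mZ : forall i, fin_measurable (Z i).

Let box (E : forall i, set (A i)) := [set w | forall i, E i (Z i w)].

(** Independence of [D] from the family of the [Z i] with [K i], phrased with
    events on the whole family that are trivial outside [K].  In this form an
    event on one more variable is absorbed by changing a single entry of [E],
    so that independence passes from an event to a later one without any
    enumeration of the joint values of the earlier variables. *)
Definition event_indep (D : set Omega) (K : pred I) : Prop :=
  measurable D /\ forall E : forall i, set (A i),
    (forall i, ~~ K i -> E i = setT) ->
    fine (P (D `&` box E)) = fine (P D) * \prod_i fine (P (Z i @^-1` E i)).

Lemma event_indepT : mutually_independent P Z -> event_indep setT xpredT.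
Proof.
move=> indZ; split=> // E _.
by rewrite setTI indZ probability_setT mul1r.
Qed.

Lemma event_indepW (D : set Omega) (K K' : pred I) :
  (forall i, K' i -> K i) -> event_indep D K -> event_indep D K'.
Proof.
move=> K'K [mD indD]; split=> // E ET; apply: indD => i.
by move=> nKi; apply: ET; apply: contra nKi; exact: K'K.
Qed.

(** Both parts are the product rule for [D], applied to the family that has [B]
    at the fresh index [j]: intersecting with a fresh event multiplies the
    probability and uses up the index. *)
Lemma event_indep_cut (D : set Omega) (K : pred I) (j : I) (B : set (A j)) :
  K j -> event_indep D K ->
  fine (P (D `&` Z j @^-1` B)) = fine (P D) * fine (P (Z j @^-1` B)) /\
  event_indep (D `&` Z j @^-1` B) (fun i => K i && (i != j)).
Proof.
move=> Kj [mD indD].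
have cutE E : (forall i, ~~ (K i && (i != j)) -> E i = setT) ->
    fine (P (D `&` Z j @^-1` B `&` box E)) =
    fine (P D) * fine (P (Z j @^-1` B)) * \prod_i fine (P (Z i @^-1` E i)).
  (* The type ascription [T] lets the dependent update find its codomain. *)
  move=> ET; pose T i : Type := set (A i).
  pose E' : forall i, T i := @eqtype.dfwith I T E j B.
  have E'j : E' j = B by exact: dfwith_in.
  have E'i i : i != j -> E' i = E i.
    by move=> ij; rewrite /E' dfwith_out// eq_sym.
  have Ej : E j = setT by apply: ET; rewrite eqxx andbF.
  have -> : D `&` Z j @^-1` B `&` box E = D `&` box E'.
    apply/seteqP; split=> w.
    - move=> [[Dw Bw] Ew]; split=> // i.
      by have [->|ij] := eqVneq i j; [rewrite E'j|rewrite E'i].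
    - move=> [Dw Ew]; split; [split=> //|move=> i].
        by have := Ew j; rewrite E'j.
      by have [->|ij] := eqVneq i j; [rewrite Ej|rewrite -E'i].
  rewrite indD; last first.
    move=> i nKi; have ij : i != j by apply: contraNneq nKi => ->.
    by rewrite E'i// ET// (negPf nKi).
  rewrite (bigD1 j)//= E'j [in RHS](bigD1 j)//= Ej preimage_setT.
  rewrite probability_setT mul1r mulrA; congr (_ * _).
  by apply: eq_bigr => i ij; rewrite E'i.
have probE :
    fine (P (D `&` Z j @^-1` B)) = fine (P D) * fine (P (Z j @^-1` B)).
  have := cutE (fun=> setT) (fun _ _ => erefl).
  rewrite big1 => [|i _]; last by rewrite preimage_setT probability_setT.
  rewrite mulr1 => <-; congr (fine (P _)).
  by apply/seteqP; split => [w DBw|w []//]; split.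
split=> //; split; last by move=> E ET; rewrite cutE// probE.
by apply: measurableI => //; exact: fin_measurable_preimage.
Qed.

Lemma event_indep_bigcup (S : finType) (D : S -> set Omega) (K : pred I) :
  (forall s, event_indep (D s) K) ->
  (forall s s' w, D s w -> D s' w -> s = s') ->
  event_indep (\bigcup_s D s) K.
Proof.
move=> indD disD; have mD s : measurable (D s) by case: (indD s).
have mbox E : measurable (box E).
  have -> : box E = \bigcap_i Z i @^-1` E i.
    by apply/seteqP; split => [w Ew i _|w Ew i]; exact: Ew.
  apply: fin_bigcap_measurable; first exact: finite_finset.
  by move=> i _; exact: fin_measurable_preimage.
split=> [|E ET].
  by apply: fin_bigcup_measurable => // s _; exact: finite_finset.
rewrite setI_bigcupl prob_bigcup_fin.
- rewrite prob_bigcup_fin// mulr_suml; apply: eq_bigr => s _.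
  by case: (indD s) => _ ->.
- by move=> s; exact: measurableI.
- by move=> s s' w [Ds _] [Ds' _]; exact: disD Ds Ds'.
Qed.

End IndependentEvents.

Lemma integral_fin_valued (A : finType) (Z : Omega -> A) (C : A -> R) :
  fin_measurable Z -> (forall a, 0 <= C a) ->
  (\int[P]_w (C (Z w))%:E = (\sum_a fine (P (Z @^-1` [set a])) * C a)%:E)%E.
Proof.
move=> mZ C0.
have -> : (fun w => (C (Z w))%:E) =
    (fun w => \sum_a ((C a)%:E * (\1_(Z @^-1` [set a]) w)%:E))%E.
  apply/funext => w; rewrite (bigD1 (Z w))//= big1 ?adde0.
    by rewrite indicE mem_set// mule1.
  move=> a aZ; rewrite indicE memNset ?mule0//= => Za.
  by rewrite Za eqxx in aZ.
have mI a : measurable_fun setT (EFin \o (\1_(Z @^-1` [set a]) : Omega -> R)).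
  by apply/measurable_EFinP; exact: measurable_indic.
rewrite ge0_integral_sum//; first last.
- by move=> a w _; rewrite mule_ge0// lee_fin.
- by move=> a; apply: measurable_funeM; exact: mI.
rewrite -sumEFin; apply: eq_bigr => a _.
rewrite ge0_integralZl_EFin//; last exact: mI.
by rewrite integral_indic// setIT EFinM fineK ?fin_num_measure// muleC.
Qed.

End FiniteProbability.

(** * The dynamic program on sub-densities *)

Section DynamicProgram.
Variables (R : realType) (M : team_model R).
Variable kernel : forall t, Xs M t -> U1s M t -> U2s M t ->
  Xs M t.+1 -> Y1s M t.+1 -> Y2s M t.+1 -> R.
(* [x0] only provides the value of the belief at a private information of mass
   zero. *)
Variable x0 : forall t, Xs M t.

(** Unnormalized laws of (X_t, L_t) on the event that agent 2 has a given
    memory. *)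
Definition subdensity (t : nat) : Type := Xs M t -> priv1 M t -> R.

Definition scale t (c : R) (mu : subdensity t) : subdensity t :=
  fun x l => c * mu x l.

(** Pi_t^1 as a function of the sub-density and of agent 1's private
    information: conditioning on the latter is normalizing a column. *)
Definition belief t (mu : subdensity t) (l : priv1 M t) : dist R (Xs M t) :=
  insubd (point_mass R (x0 t)) [ffun x => mu x l / \sum_x' mu x' l].

(** Here and below [a] is the response of agent 1 to each private information,
    a prescription composed with the belief. *)
Definition stage_cost t (mu : subdensity t) (a : priv1 M t -> U1s M t)
    (u2 : U2s M t) : R :=
  \sum_x \sum_l mu x l * cost x (a l) u2.

(** The sub-density at time t+1 on the event that agent 2 moreover plays [u2] and
    observes [y2]; the indicator records that the new private information
    contains the action that agent 1 actually takes. *)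
Definition update t (mu : subdensity t) (a : priv1 M t -> U1s M t)
    (u2 : U2s M t) (y2 : Y2s M t.+1) : subdensity t.+1 :=
  fun x' l' => let: (l, u1, y1) := l' in
    (a l == u1)%:R * \sum_x mu x l * kernel x u1 u2 x' y1 y2.

(** Bellman's recursion with [n] stages left. *)
Fixpoint value (n : nat) : forall t, subdensity t -> R :=
  if n is m.+1 then fun t mu =>
    inf (range (fun qu : prescription M t * U2s M t =>
      stage_cost mu (qu.1 \o belief mu) qu.2 +
      \sum_y value m (update mu (qu.1 \o belief mu) qu.2 y)))
  else fun _ _ => 0.

Definition action_value n t (mu : subdensity t) (a : priv1 M t -> U1s M t)
    (u2 : U2s M t) : R :=
  stage_cost mu a u2 + \sum_y value n (update mu a u2 y).

Definition decision_value n t (mu : subdensity t)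
    (qu : prescription M t * U2s M t) : R :=
  action_value n mu (qu.1 \o belief mu) qu.2.

(** Private information of mass zero contributes nothing, so the belief there
    can be arbitrary. *)
Lemma action_value_ext n t (mu : subdensity t) (a a' : priv1 M t -> U1s M t) u2 :
  (forall x l, mu x l != 0 -> a l = a' l) ->
  action_value n mu a u2 = action_value n mu a' u2.
Proof.
move=> aa'; rewrite /action_value; congr (_ + _).
  apply: eq_bigr => x _; apply: eq_bigr => l _.
  by have [->|/aa' ->//] := eqVneq (mu x l) 0; rewrite !mul0r.
apply: eq_bigr => y _; congr (value _ _).
apply/funext => x'; apply/funext => -[[l u1] y1] /=.
have [/existsP[x /aa' ->//]|/existsPn mu0] := boolP [exists x, mu x l != 0].
by rewrite big1 ?mulr0// => x _; have /negPn/eqP -> := mu0 x; rewrite mul0r.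
Qed.

(** The set of prescriptions is infinite, but [mu] sees only the responses to the
    finitely many private informations. *)
Lemma decision_value_min n t (mu : subdensity t)
    (qu0 : prescription M t * U2s M t) :
  exists qu, forall qu', decision_value n mu qu <= decision_value n mu qu'.
Proof.
pose h (qu : prescription M t * U2s M t) :
  ({ffun priv1 M t -> U1s M t} * U2s M t)%type := ([ffun l => qu.1 (belief mu l)], qu.2).
apply: (@finite_min_exists _ _ _ h _ _ qu0) => -[q u] [q' u'] [/ffunP qq' ->].
rewrite /decision_value; apply: action_value_ext => x l _ /=.
by have := qq' l; rewrite !ffunE.
Qed.

Lemma value_minimizer n t (mu : subdensity t) qu :
  (forall qu', decision_value n mu qu <= decision_value n mu qu') ->
  value n.+1 mu = decision_value n mu qu.
Proof. exact: inf_rangeE. Qed.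

Lemma value_le n t (mu : subdensity t) qu :
  value n.+1 mu <= decision_value n mu qu.
Proof.
have [qu1 qu1min] := decision_value_min n mu qu.
by rewrite (value_minimizer qu1min).
Qed.

Lemma belief_scale t (c : R) (mu : subdensity t) :
  c != 0 -> belief (scale c mu) = belief mu.
Proof.
move=> c0; apply/funext => l; congr (insubd _ _); apply/ffunP => x.
by rewrite !ffunE -mulr_sumr invfM mulrACA divff// mul1r.
Qed.

Lemma stage_cost_scale t c (mu : subdensity t) a u2 :
  stage_cost (scale c mu) a u2 = c * stage_cost mu a u2.
Proof.
rewrite /stage_cost mulr_sumr; apply: eq_bigr => x _.
by rewrite mulr_sumr; apply: eq_bigr => l _; rewrite mulrA.
Qed.

Lemma update_scale t c (mu : subdensity t) a u2 y :
  update (scale c mu) a u2 y = scale c (update mu a u2 y).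
Proof.
apply/funext => x'; apply/funext => -[[l u1] y1]; rewrite /scale/=.
rewrite [RHS]mulrCA [in RHS]mulr_sumr; congr (_ * _).
by apply: eq_bigr => x _; rewrite mulrA.
Qed.

(** Beliefs are invariant under scaling by a nonzero factor, while costs and
    updates are linear; for the factor 0 the beliefs differ, but both sides
    vanish. *)
Lemma decision_value_scale_step n t (c : R) (mu : subdensity t) qu :
  (forall t' (nu : subdensity t'), 0 <= c ->
    value n (scale c nu) = c * value n nu) ->
  0 <= c -> decision_value n (scale c mu) qu = c * decision_value n mu qu.
Proof.
move=> valS c0.
have actS a u2 :
    action_value n (scale c mu) a u2 = c * action_value n mu a u2.
  rewrite /action_value stage_cost_scale mulrDr; congr (_ + _).
  by rewrite mulr_sumr; apply: eq_bigr => y _; rewrite update_scale valS.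
rewrite /decision_value actS.
by have [->|/belief_scale ->//] := eqVneq c 0; rewrite !mul0r.
Qed.

(* If no decision existed at some time, [value] would be the infimum of the
   empty set. *)
Hypothesis decision0 : forall t, prescription M t * U2s M t.

Lemma value_scale n t (c : R) (mu : subdensity t) :
  0 <= c -> value n (scale c mu) = c * value n mu.
Proof.
elim: n t mu => [|n IH] t mu c0; first by rewrite /= mulr0.
have [qu qumin] := decision_value_min n mu (decision0 t).
have decS := fun qu => decision_value_scale_step mu qu IH c0.
rewrite (value_minimizer qumin) -decS; apply: value_minimizer => qu'.
by rewrite !decS ler_wpM2l.
Qed.

Lemma decision_value_scale n t (c : R) (mu : subdensity t) qu :
  0 <= c -> decision_value n (scale c mu) qu = c * decision_value n mu qu.
Proof. by apply: decision_value_scale_step => t' mu'; exact: value_scale. Qed.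

End DynamicProgram.

(** * Realizing laws that depend on the law of the process *)

Section Realization.
Variables (R : realType) (M : team_model R).
Variables (d : measure_display) (Omega : measurableType d).
Variables (P : probability Omega R) (N : primitives M Omega).
(* A rule sees the whole random variable of time t, hence may use conditional
   laws of it. *)
Variable rule : forall t, (Omega -> Xs M t * mem1 M t) ->
  Defs.mem2 M t -> prescription M t * U2s M t.

Fixpoint feedback_process (t : nat) : Omega -> Xs M t * mem1 M t :=
  match t return Omega -> Xs M t * mem1 M t with
  | 0 => fun w =>
      let x := X0 N w in
      (x, (obs2 x (V2 N 0 w), obs1 x (V1 N 0 w)))
  | s.+1 => fun w =>
      let: (x, (m2, l)) := feedback_process s w in
      let pi1 := cond_law P (fun w' => (feedback_process s w').1)
                   [set w' | (feedback_process s w').2 = (m2, l)] in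
      let u1 := (rule (feedback_process s) m2).1 pi1 in
      let u2 := (rule (feedback_process s) m2).2 in
      let x' := dyn x u1 u2 (W N s w) in
      (x', ((m2, u2, obs2 x' (V2 N s.+1 w)), (l, u1, obs1 x' (V1 N s.+1 w))))
  end.

(** The process at time t involves only the strategies before t, so the fixed
    point equation between strategies and process is solved by recursion. *)
Lemma feedback_realization : exists (psi : presc_strategy M) (g : control_strategy M),
  forall t m, (psi t m, g t m) = rule (process P N psi g t) m.
Proof.
pose psi : presc_strategy M := fun t m => (rule (feedback_process t) m).1.
pose g : control_strategy M := fun t m => (rule (feedback_process t) m).2.
exists psi, g => t m; rewrite (_ : process P N psi g t = feedback_process t).
  by rewrite -surjective_pairing.
by elim: t {m} => [//|t IH]; apply/funext => w /=; rewrite IH.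
Qed.

End Realization.

(** * The law of the process under given strategies *)

Section ProcessLaw.
Variables (R : realType) (M : team_model R).
Variables (d : measure_display) (Omega : measurableType d).
Variables (P : probability Omega R) (N : primitives M Omega).
Hypothesis hN : independent_primitives P N.

Definition primitive_kernel t (x : Xs M t) (u1 : U1s M t) (u2 : U2s M t)
    (x' : Xs M t.+1) (y1 : Y1s M t.+1) (y2 : Y2s M t.+1) : R :=
  fine (P (W N t @^-1` [set z | dyn x u1 u2 z = x'])) *
  fine (P (V2 N t.+1 @^-1` [set v | obs2 x' v = y2])) *
  fine (P (V1 N t.+1 @^-1` [set v | obs1 x' v = y1])).

(** The primitive variables that the process up to time t does not involve. *)
Definition fresh (t : nat) : pred (prim_index M) := fun i =>
  match i with
  | inl (inl (inl _)) => false
  | inl (inl (inr s)) => t <= s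
  | inl (inr s) => t < s
  | inr s => t < s
  end%N.

Variables (psi : presc_strategy M) (g : control_strategy M).
Local Notation proc := (process P N psi g).

Definition reaction1 t (m : Defs.mem2 M t) (l : priv1 M t) : U1s M t :=
  psi m (cond_law P (state P N psi g t)
           [set w | memory1 P N psi g t w = (m, l)]).

(** The conditions that the recorded actions are those prescribed do not involve
    the primitive variables; they are put into the event on W_t so that each
    piece remains a cut of an event at time t by three fresh events. *)
Lemma process_step_set t (m : Defs.mem2 M t) (l : priv1 M t)
    u1 u2 (x' : Xs M t.+1) (y1 : Y1s M t.+1) (y2 : Y2s M t.+1) :
  proc t.+1 @^-1` [set (x', ((m, u2, y2), (l, u1, y1)))] =
  \bigcup_x (proc t @^-1` [set (x, (m, l))] `&`
    W N t @^-1` [set z | [/\ g m = u2, reaction1 m l = u1 & dyn x u1 u2 z = x']] `&`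
    V2 N t.+1 @^-1` [set v | obs2 x' v = y2] `&`
    V1 N t.+1 @^-1` [set v | obs1 x' v = y1]).
Proof.
apply/seteqP; split => w /=.
  case procE : (process P N psi g t w) => [x [m1 l1]] /= [].
  move=> xE mE uE yE lE u1E y1E; subst m1 l1 x' y1 y2 u1 u2.
  by exists x => //; do !split; exact: procE.
move=> [x _ [[[/= -> [<- <- <-]] <-] <-]] //.
Qed.

Lemma process_step_slice t (D : set Omega) (B : set (Ws M t))
    (B2 : set (V2s M t.+1)) (B1 : set (V1s M t.+1)) :
  (t < horizon M)%N -> event_indep P (prim N) D (fresh t) ->
  fine (P (D `&` W N t @^-1` B `&` V2 N t.+1 @^-1` B2 `&` V1 N t.+1 @^-1` B1)) =
    fine (P D) * fine (P (W N t @^-1` B)) * fine (P (V2 N t.+1 @^-1` B2)) *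
    fine (P (V1 N t.+1 @^-1` B1)) /\
  event_indep P (prim N)
    (D `&` W N t @^-1` B `&` V2 N t.+1 @^-1` B2 `&` V1 N t.+1 @^-1` B1)
    (fresh t.+1).
Proof.
move=> tT indD; have [mN _] := hN.
have tT1 : (t < (horizon M).+1)%N by exact: ltnW.
have tT2 : (t.+1 < (horizon M).+1)%N by [].
pose iW : prim_index M := inl (inl (inr (Ordinal tT1))).
pose iV1 : prim_index M := inl (inr (Ordinal tT2)).
pose iV2 : prim_index M := inr (Ordinal tT2).
have [PW indW] := event_indep_cut mN (j := iW) B (leqnn t) indD.
have fV2 : fresh t iV2 && (iV2 != iW) by rewrite /= ltnS leqnn.
have [PV2 indV2] := event_indep_cut mN (j := iV2) B2 fV2 indW.
have fV1 : (fresh t iV1 && (iV1 != iW)) && (iV1 != iV2) by rewrite /= ltnS leqnn.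
have [PV1 indV1] := event_indep_cut mN (j := iV1) B1 fV1 indV2.
split; first by rewrite [LHS]PV1 PV2 PW.
apply: event_indepW indV1 => -[[[[]|s]|s]|s]//= ts.
all: rewrite (ltnW ts)/= ?andbT.
all: by apply: contraTneq ts => -[->]; rewrite ltnn.
Qed.

(** By induction on time: the event at time t+1 is a disjoint union, over the
    unobserved previous state, of cuts of events at time t by W_t and the two
    noises of time t+1. *)
Lemma process_indep t (p : Xs M t * mem1 M t) :
  (t <= horizon M)%N -> event_indep P (prim N) (proc t @^-1` [set p]) (fresh t).
Proof.
have [mN iN] := hN.
elim: t p => [[x [y2 y1]] _|t IH [x' [[[m u2] y2] [[l u1] y1]]] tT].
  pose iX : prim_index M := inl (inl (inl tt)).
  pose iV1 : prim_index M := inl (inr ord0).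
  pose iV2 : prim_index M := inr ord0.
  have indT := event_indepT iN.
  have [_ indX] := event_indep_cut mN (j := iX) [set x] isT indT.
  have [_ indV2] :=
    event_indep_cut mN (j := iV2) [set v | obs2 x v = y2] isT indX.
  have [_ indV1] :=
    event_indep_cut mN (j := iV1) [set v | obs1 x v = y1] isT indV2.
  rewrite setTI in indV1.
  rewrite (_ : _ @^-1` _ = prim N iX @^-1` [set x] `&`
    prim N iV2 @^-1` [set v | obs2 x v = y2] `&`
    prim N iV1 @^-1` [set v | obs1 x v = y1]); last first.
    by apply/seteqP; split => w /= => [[<- <- <-]|[[-> ->] ->]].
  by apply: event_indepW indV1 => -[[[[]|s]|s]|s]//= s0;
    rewrite ?andbT; apply: contraTneq s0 => -[->].
rewrite process_step_set; apply: event_indep_bigcup => // [x|x x1 w].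
  exact: (process_step_slice _ _ _ tT (IH (x, (m, l)) (ltnW tT))).2.
by move=> [[[/= -> _] _] _] [[[/= [->] _] _] _].
Qed.

Lemma process_measurable t : (t <= horizon M)%N -> fin_measurable (proc t).
Proof. by move=> tT p; case: (process_indep p tT). Qed.

Definition joint t (m : Defs.mem2 M t) : subdensity M t :=
  fun x l => fine (P (proc t @^-1` [set (x, (m, l))])).

(** The filter equation before normalization, valid at null memories too; the
    factor discards memories that record an action agent 2 does not take. *)
Lemma joint_step t (m : Defs.mem2 M t) (u2 : U2s M t) (y2 : Y2s M t.+1) :
  (t < horizon M)%N ->
  joint (t := t.+1) (m, u2, y2) =
  scale (g m == u2)%:R
    (update primitive_kernel (joint m) (reaction1 m) (g m) y2).
Proof.
move=> tT; apply/funext => x'; apply/funext => -[[l u1] y1].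
rewrite /scale /joint process_step_set prob_bigcup_fin; first last.
- by move=> x x1 w [[[/= -> _] _] _] [[[/= [->] _] _] _].
- move=> x; have indx := process_indep (x, (m, l)) (ltnW tT).
  by have [_ []] := process_step_slice
    [set z | [/\ g m = u2, reaction1 m l = u1 & dyn x u1 u2 z = x']]
    [set v | obs2 x' v = y2] [set v | obs1 x' v = y1] tT indx.
rewrite /= 2!mulr_sumr; apply: eq_bigr => x _.
have [-> _] := process_step_slice
  [set z | [/\ g m = u2, reaction1 m l = u1 & dyn x u1 u2 z = x']]
  [set v | obs2 x' v = y2] [set v | obs1 x' v = y1] tT
  (process_indep (x, (m, l)) (ltnW tT)).
have P0 : fine (P set0) = 0 by rewrite measure0.
have [gm|gm] := eqVneq (g m) u2; last first.
  rewrite mul0r (_ : W N t @^-1` _ = set0) ?P0 ?mulr0 ?mul0r//.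
  by apply/seteqP; split => // w [/= /eqP]; rewrite (negPf gm).
have [al|al] := eqVneq (reaction1 m l) u1; last first.
  rewrite mul0r mulr0 (_ : W N t @^-1` _ = set0) ?P0 ?mulr0 ?mul0r//.
  by apply/seteqP; split => // w [/= _ /eqP]; rewrite (negPf al).
rewrite !mul1r /primitive_kernel !mulrA gm; congr (_ * fine (P _) * _ * _).
by apply/seteqP; split => w /= => [[]|].
Qed.

Lemma joint_ge0 t (m : Defs.mem2 M t) x l : 0 <= joint m x l.
Proof. by rewrite /joint fine_ge0. Qed.

(** At private information of positive mass the two default values of
    conditional laws, which differ, do not intervene. *)
Lemma belief_joint (x0 : forall t, Xs M t) t (m : Defs.mem2 M t) x l :
  (t <= horizon M)%N -> joint m x l != 0 ->
  belief x0 (joint m) l =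
  cond_law P (state P N psi g t) [set w | memory1 P N psi g t w = (m, l)].
Proof.
move=> tT jx; have mp := process_measurable tT.
set B := [set w | _].
have BE : B = \bigcup_x (proc t @^-1` [set (x, (m, l))]).
  apply/seteqP; split => [w|w [x' _ Ew]]; rewrite /B/= /memory1.
    by move=> Ew; exists (proc t w).1 => //=; rewrite -Ew -surjective_pairing.
  by rewrite Ew.
have PB : fine (P B) = \sum_x' joint m x' l.
  by rewrite BE prob_bigcup_fin// => x1 x2 w /= -> [].
have mB : measurable B.
  by rewrite BE; apply: fin_bigcup_measurable => //; exact: finite_finset.
have PB0 : P B != 0%E.
  apply/eqP => PB0; move: PB; rewrite PB0/= => /esym/eqP.
  rewrite psumr_eq0; last by move=> *; exact: joint_ge0.
  by move=> /allP/(_ x); rewrite mem_index_enum (negPf jx) => /(_ isT).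
(* Once the candidate mass function is known to be that of a distribution, the
   default of [insubd] is irrelevant. *)
rewrite /belief; set f := (X in insubd _ X).
suff -> : f = \val (cond_law P (state P N psi g t) B) by rewrite valKd.
apply/ffunP => x'; rewrite ffunE -PB.
have mst : fin_measurable (state P N psi g t).
  by move=> x1; exact: (fin_measurable_preimage [set p | p.1 = x1] mp).
rewrite [RHS](cond_lawE _ mst mB PB0); congr (fine (P _) / _).
apply/seteqP; split => [w /= Ew|w [/= <- <-]].
  by rewrite /B /state /memory1 /= Ew.
by rewrite /= -surjective_pairing.
Qed.

Definition posterior2 t (m : Defs.mem2 M t) : info2 M t :=
  cond_law P (fun w => ((proc t w).1, (proc t w).2.2))
    [set w | (proc t w).2.1 = m].

(** Also true at null memories, where both sides vanish. *)
Lemma joint_posterior2 t (m : Defs.mem2 M t) : (t <= horizon M)%N ->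
  joint m = scale (fine (P [set w | (proc t w).2.1 = m]))
                  (fun x l => posterior2 m (x, l)).
Proof.
move=> tT; have mp := process_measurable tT.
set B := [set w | _]; have mB : measurable B.
  exact: (fin_measurable_preimage [set p | p.2.1 = m] mp).
apply/funext => x; apply/funext => l; rewrite /scale.
have [PB0|PB0] := eqVneq (P B) 0%E.
  rewrite PB0 mul0r /joint (_ : P _ = 0%E)//.
  apply: (subset_measure0 _ mB _ PB0); first exact: mp.
  by move=> w /= Ew; rewrite /B/= Ew.
have mZ : fin_measurable (fun w => ((proc t w).1, (proc t w).2.2)).
  move=> z; exact: (fin_measurable_preimage [set p | (p.1, p.2.2) = z] mp).
rewrite /posterior2 (cond_lawE _ mZ mB PB0) mulrC divfK; last first.
  apply: contra PB0 => /eqP PB.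
  by rewrite -(fineK (fin_num_measure P _ mB)) PB.
congr (fine (P _)); apply/seteqP; split => w /= => [Ew|].
  by rewrite /B /= Ew.
by rewrite /B /=; case: (proc t w) => x1 [m1 l1] /= [[-> ->] ->].
Qed.

Lemma memory2_past t w w' s :
  memory2 P N psi g t w' = memory2 P N psi g t w -> (s <= t)%N ->
  memory2 P N psi g s w' = memory2 P N psi g s w.
Proof.
elim: t => [|t IH]; first by rewrite leqn0 => + /eqP ->.
move=> m2E; rewrite leq_eqVlt => /predU1P[->//|]; rewrite ltnS; apply: IH.
by move: m2E; rewrite !memory2S => -[].
Qed.

(** Past prescriptions are functions of past memories, which are recorded in the
    present one; conditioning on them adds nothing. *)
Lemma Pi2_posterior2 t w :
  Pi2 P N psi g t w = posterior2 (memory2 P N psi g t w).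
Proof.
congr (cond_law P _ _); apply/seteqP; split => [w' []//|w' /= m2E].
by split=> // s st; rewrite /Gamma (memory2_past m2E (ltnW st)).
Qed.

Definition expected_cost t : R :=
  \sum_(m : Defs.mem2 M t) stage_cost (joint m) (reaction1 m) (g m).

Lemma J_expected_cost :
  J P N psi g = (\sum_(t < (horizon M).+1) expected_cost t)%:E.
Proof.
pose C t (p : Xs M t * mem1 M t) :=
  cost p.1 (reaction1 p.2.1 p.2.2) (g p.2.1).
have CE t w : cost (state P N psi g t w) (U1 P N psi g t w) (U2 P N psi g t w) =
    C t (proc t w).
  rewrite /U1 /Gamma /Pi1 /U2 /C /reaction1 /memory2.
  by rewrite -surjective_pairing.
rewrite /J unlock.
under eq_integral.
  move=> w _; rewrite /total_cost -sumEFin.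
  under eq_bigr => t _ do rewrite CE.
  over.
have C0 (t : 'I_(horizon M).+1) p : 0 <= C t p by apply: cost_ge0; rewrite -ltnS.
have mt (t : 'I_(horizon M).+1) : fin_measurable (proc t).
  by apply: process_measurable; rewrite -ltnS.
rewrite ge0_integral_sum//; first last.
- by move=> t w _; rewrite lee_fin.
- by move=> t; apply/measurable_EFinP; exact: measurable_fun_fin_valued.
rewrite -sumEFin; apply: eq_bigr => t _.
rewrite (integral_fin_valued _ (mt t) (C0 t)); congr EFin.
transitivity (\sum_x \sum_(q : mem1 M t)
    fine (P (proc t @^-1` [set (x, q)])) * C t (x, q)).
  by rewrite pair_bigA; apply: eq_bigr => -[x q].
rewrite /expected_cost /stage_cost [RHS]exchange_big/=; apply: eq_bigr => x _.
by rewrite pair_bigA; apply: eq_bigr => -[m l].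
Qed.

(** Each reachable memory at time t+1 extends one memory [m] by the action [g m]
    and an observation; the others carry the zero sub-density, whose value
    is 0. *)
Lemma bellman_identity (x0 : forall t, Xs M t)
    (decision0 : forall t, prescription M t * U2s M t) n t :
  (n + t = horizon M)%N ->
  \sum_(m : Defs.mem2 M t)
    action_value primitive_kernel x0 n (joint m) (reaction1 m) (g m) =
  expected_cost t + \sum_(m : Defs.mem2 M t.+1) value primitive_kernel x0 n (joint m).
Proof.
move=> ntT; rewrite /action_value big_split/=; congr (_ + _).
(* After the horizon the sub-densities need not follow [update], but the value
   is zero. *)
case: n ntT => [|n] ntT; first by rewrite /= !big1// => m _; rewrite big1.
have tT : (t < horizon M)%N by rewrite -ntT addSn ltnS leq_addl.
transitivity (\sum_(m : Defs.mem2 M t) \sum_(u2 : U2s M t) \sum_(y : Y2s M t.+1)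
    value primitive_kernel x0 n.+1 (joint (t := t.+1) (m, u2, y))); last first.
  by rewrite !pair_bigA; apply: eq_bigr => -[[m u2] y].
apply: eq_bigr => m _; rewrite exchange_big; apply: eq_bigr => y _.
rewrite (bigD1 (g m))// big1 => [|u2 /negPf u2g].
  by rewrite joint_step// value_scale// eqxx mul1r Monoid.mulm1.
by rewrite joint_step// value_scale// eq_sym u2g mul0r.
Qed.

Lemma action_value_reaction1 (x0 : forall t, Xs M t) n t (m : Defs.mem2 M t) :
  (t <= horizon M)%N ->
  action_value primitive_kernel x0 n (joint m) (reaction1 m) (g m) =
  decision_value primitive_kernel x0 n (joint m) (psi m, g m).
Proof.
move=> tT; apply: action_value_ext => x l jx.
by rewrite /= (belief_joint x0 tT jx).
Qed.

Lemma value_le_cost_to_go (x0 : forall t, Xs M t)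
    (decision0 : forall t, prescription M t * U2s M t) n t :
  (n + t = (horizon M).+1)%N ->
  \sum_(m : Defs.mem2 M t) value primitive_kernel x0 n (joint m) <=
  \sum_(t <= s < (horizon M).+1) expected_cost s.
Proof.
elim: n t => [|n IH] t; first by move=> <-; rewrite add0n big_geq// big1.
rewrite addSn -addnS => nt.
have tT : (t <= horizon M)%N by rewrite -ltnS -nt leq_addl.
rewrite big_ltn ?ltnS//.
have ntT : (n + t = horizon M)%N by apply/eqP; rewrite -eqSS -addnS nt.
apply: le_trans (lerD (lexx _) (IH _ nt)); rewrite -(bellman_identity x0)//.
apply: ler_sum => m _; rewrite action_value_reaction1//; exact: value_le.
Qed.

Lemma value_eq_cost_to_go (x0 : forall t, Xs M t)
    (decision0 : forall t, prescription M t * U2s M t) n t :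
  (forall k s (m : Defs.mem2 M s), (k + s = horizon M)%N ->
    value primitive_kernel x0 k.+1 (joint m) =
    decision_value primitive_kernel x0 k (joint m) (psi m, g m)) ->
  (n + t = (horizon M).+1)%N ->
  \sum_(m : Defs.mem2 M t) value primitive_kernel x0 n (joint m) =
  \sum_(t <= s < (horizon M).+1) expected_cost s.
Proof.
move=> opt; elim: n t => [|n IH] t; first by move=> <-; rewrite add0n big_geq// big1.
rewrite addSn -addnS => nt.
have tT : (t <= horizon M)%N by rewrite -ltnS -nt leq_addl.
have ntT : (n + t = horizon M)%N by apply/eqP; rewrite -eqSS -addnS nt.
rewrite big_ltn ?ltnS// -IH// -(bellman_identity x0)//.
by apply: eq_bigr => m _; rewrite action_value_reaction1// opt.
Qed.

End ProcessLaw.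

(** * Structured laws suffice *)

Theorem theorem2 (R : realType) (M : team_model R)
    (d : measure_display) (Omega : measurableType d) (P : probability Omega R)
    (N : primitives M Omega) (hN : independent_primitives P N)
    (psi : presc_strategy M) (g : control_strategy M) :
  exists (psis : presc_law M) (gs : control_law M)
         (psi' : presc_strategy M) (g' : control_strategy M),
    structural_form P N psi' g' psis gs /\
    (J P N psi' g' <= J P N psi g)%E.
Proof.
(* The given strategies show that the state and decision spaces are nonempty. *)
pose x0 t : Xs M t := state P N psi g t point.
pose decision0 t : prescription M t * U2s M t :=
  (Gamma P N psi g (t := t) point, U2 P N psi g t point).
pose kernel := primitive_kernel P N.
pose optimal t (pi : info2 M t) qu := forall qu',
  decision_value kernel x0 (horizon M - t) (fun x l => pi (x, l)) qu <=
  decision_value kernel x0 (horizon M - t) (fun x l => pi (x, l)) qu'.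
have exopt t (pi : info2 M t) : {qu | optimal t pi qu}.
  exact/cid/(decision_value_min _ _ _ _ (decision0 t)).
pose law t (pi : info2 M t) := projT1 (exopt t pi).
have lawP t pi : optimal t pi (law t pi) := projT2 (exopt t pi).
have [psi' [g' realE]] := feedback_realization P N
  (fun t Z m => law t (cond_law P (fun w => ((Z w).1, (Z w).2.2))
                         [set w | (Z w).2.1 = m])).
have psiE t m : psi' t m = (law t (posterior2 P N psi' g' m)).1.
  by rewrite -[LHS]/((psi' t m, g' t m).1) realE.
have gE t m : g' t m = (law t (posterior2 P N psi' g' m)).2.
  by rewrite -[LHS]/((psi' t m, g' t m).2) realE.
exists (fun t pi => (law t pi).1), (fun t pi => (law t pi).2), psi', g'; split.
  by move=> t w _; rewrite Pi2_posterior2 /Gamma /U2 psiE gE.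
rewrite !J_expected_cost// lee_fin -!(big_mkord xpredT (expected_cost _ _ _ _)).
rewrite -(@value_eq_cost_to_go _ _ _ _ _ _ hN psi' g' x0 decision0 (horizon M).+1).
(* Both sides agree because [joint] at time 0 unfolds to the law of the primitive
   variables alone. *)
- apply: le_trans (value_le_cost_to_go hN psi g x0 decision0 (addn0 _)).
  exact: lexx.
- move=> k s m ksT.
  have sT : (s <= horizon M)%N by rewrite -ksT leq_addl.
  have kE : k = (horizon M - s)%N by rewrite -ksT addnK.
  have c0 : 0 <= fine (P [set w | (process P N psi' g' s w).2.1 = m]).
    by rewrite fine_ge0.
  rewrite joint_posterior2// value_scale// decision_value_scale//.
  congr (_ * _); rewrite kE psiE gE -surjective_pairing.
  exact/value_minimizer/lawP.
- by rewrite addn0.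
Qed.
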